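(* Let $n>3$ be an odd number such that $h=\frac{n-1}2$ is odd. Let $T\in\mathcal{BC}^{0,1}(V_n)$. Then for $p,s\in\rho_{\mathcal F}(T)$ with $s\notin[p]$, writing $R=\mathcal F_n^R(s,T)$, $L=\mathcal F_n^L(p,T)$ and $|T|^2=T\overline T$, the following equation holds: $$\begin{aligned} &R\,S_L^{-1}(p,T)+S_R^{-1}(s,T)\,L+\gamma_n\Big[s\sum_{i=0}^{h-2}\mathcal Q_s^{h-i}(T)\mathcal Q_p^{i+2}(T)p-s\sum_{i=0}^{h-2}\mathcal Q_s^{h-i}(T)\overline T\mathcal Q_p^{i+2}(T)\\ &\quad-\sum_{i=0}^{h-2}\mathcal Q_s^{h-i}(T)\overline T\mathcal Q_p^{i+2}(T)p+\sum_{i=0}^{h-2}\mathcal Q_s^{h-i}(T)\overline T^2\mathcal Q_p^{i+2}(T)+\sum_{i=0,\,i\ne\frac{h-1}2}^{h-1}\mathcal Q_s^{h-i}(T)\mathcal Q_p^{i+1}(T)\Big]\\ &\quad+\gamma_n^{-1}\big[s^hRLp^h+\mathcal A_0(s,p,T)+\mathcal B_0(s,p,T)+\mathcal C_0(s,p,T)\big]\\ &=\big\{[R-L]p-\overline s[R-L]\big\}(p^2-2s_0p+|s|^2)^{-1}, \end{aligned}$$ where, with $N=\frac{h-1}2$, $$\begin{aligned} \mathcal A_0(s,p,T)={}&-s^hRTLp^{h-1}-s^{h-1}RTLp^h+s^{h-1}RT^2Lp^{h-1}\\ &+s^hR\sum_{k=1}^{N}\binom Nk(|T|^2-2T_0p)^kLp^{h-2k}-s^hR\sum_{k=1}^{N}\binom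 Nk(|T|^2-2T_0p)^kTLp^{h-1-2k}\\ &-s^{h-1}R\sum_{k=1}^{N}\binom NkT(|T|^2-2T_0p)^kLp^{h-2k}+s^{h-1}R\sum_{k=1}^{N}\binom NkT(|T|^2-2T_0p)^kTLp^{h-1-2k}, \end{aligned}$$ $$\begin{aligned} \mathcal B_0(s,p,T)={}&\Big(\sum_{k=1}^{N}\binom Nks^{h-2k}R(|T|^2-2T_0s)^k\Big)\Big(\sum_{k=1}^{N}\binom Nk(|T|^2-2T_0p)^kLp^{h-2k}\Big)\\ &-\Big(\sum_{k=1}^{N}\binom Nks^{h-2k}R(|T|^2-2T_0s)^k\Big)\Big(\sum_{k=1}^{N}\binom Nk(|T|^2-2T_0p)^kTLp^{h-1-2k}\Big)\\ &-\Big(\sum_{k=1}^{N}\binom Nks^{h-2k-1}RT(|T|^2-2T_0s)^k\Big)\Big(\sum_{k=1}^{N}\binom Nk(|T|^2-2T_0p)^kLp^{h-2k}\Big)\\ &+\Big(\sum_{k=1}^{N}\binom Nks^{h-2k-1}RT(|T|^2-2T_0s)^k\Big)\Big(\sum_{k=1}^{N}\binom Nk(|T|^2-2T_0p)^kTLp^{h-1-2k}\Big), \end{aligned}$$ $$\begin{aligned} \mathcal C_0(s,p,T)={}&\Big(\sum_{k=1}^{N}\binom Nks^{h-2k}R(|T|^2-2T_0s)^k\Big)Lp^h-\Big(\sum_{k=1}^{N}\binom Nks^{h-2k}R(|T|^2-2T_0s)^kT\Big)Lp^{h-1}\\ &-\Big(\sum_{k=1}^{N}\binom Nks^{h-1-2k}RT(|T|^2-2T_0s)^k\Big)Lp^h+\Big(\sum_{k=1}^{N}\binom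 Nks^{h-1-2k}RT(|T|^2-2T_0s)^kT\Big)Lp^{h-1}. \end{aligned}$$
   Context: $\mathbb R_n$ is the real Clifford algebra generated by $e_1,\dots,e_n$ with $e_\ell^2=-1$ and $e_\ell e_m+e_me_\ell=0$ for $\ell\neq m$. A point of $\mathbb R^{n+1}$ is identified with the paravector $x=x_0+\underline x$, $\underline x=\sum_{j=1}^n x_je_j$; $\overline x=x_0-\underline x$, $|x|^2=\sum_{j=0}^nx_j^2$. $\mathbb S$ is the set of $\underline x$ with $|\underline x|=1$ and $[x]=\{x_0+J|\underline x|:J\in\mathbb S\}$. $V$ is a real Banach space, $V_n=V\otimes\mathbb R_n$ is the associated two-sided Banach module over $\mathbb R_n$, and $\mathcal B(V_n)$ is the space of bounded right linear operators on $V_n$. Clifford numbers act on operators by $(aT)(v)=a\,T(v)$, $(Ta)(v)=T(av)$; products of operators are compositions. $\mathcal{BC}^{0,1}(V_n)$ is the set of paravector operators $T=T_0+\sum_{\ell=1}^n e_\ell T_\ell$ with pairwise commuting components $T_\ell\in\mathcal B(V)$ (acting componentwise on $V_n$). Put $\overline T=T_0-\sum_{\ell=1}^n e_\ell T_\ell$, so that $T+\overline T=2T_0$ and $T\overline T=\sum_{\ell=0}^nT_\ell^2$. $\rho_{\mathcal F}(T)$ is the set of $s\in\mathbb R^{n+1}$ such that $s^2\mathcal I-s(T+\overline T)+T\overline T$ is invertible in $\mathcal B(V_n)$. For $s\in\rho_{\mathcal F}(T)$: $\mathcal Q_s(T)=(s^2\mathcal I-s(T+\overline T)+T\overline T)^{-1}$,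 $\mathcal Q_s^k(T)=(\mathcal Q_s(T))^k$, $S_L^{-1}(s,T)=(s\mathcal I-\overline T)\mathcal Q_s(T)$, $S_R^{-1}(s,T)=\mathcal Q_s(T)(s\mathcal I-\overline T)$, $\mathcal F_n^L(s,T)=\gamma_n(s\mathcal I-\overline T)\mathcal Q_s(T)^{\frac{n+1}2}$, $\mathcal F_n^R(s,T)=\gamma_n\mathcal Q_s(T)^{\frac{n+1}2}(s\mathcal I-\overline T)$, where $\gamma_n=(-1)^{\frac{n-1}2}2^{n-1}\big[\big(\frac{n-1}2\big)!\big]^2$. *)

(* Defs.v *)
From HB Require Import structures.
From mathcomp Require Import all_boot all_order all_algebra.
From mathcomp Require Import boolp classical_sets functions reals normedtype.
From mathcomp Require Import finset ring.

Set Implicit Arguments.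
Unset Strict Implicit.
Unset Printing Implicit Defensive.

Import Order.TTheory GRing.Theory Num.Theory.
Local Open Scope ring_scope.

(* Two-sided inverses are defined for rings in which 1 = 0 is allowed, since
   bounded operators on the zero space form such a ring. *)
Section Inverse.
Variable A : pzRingType.
Implicit Types x y : A.

Definition is_inverse x y := x * y = 1 /\ y * x = 1.
Definition invertible x := exists y, is_inverse x y.
(* The inverse of x; meaningful only if x is invertible. *)
Definition inverse x : A := xget 0 (is_inverse x).

Lemma inverse_unique x y z : is_inverse x y -> is_inverse x z -> y = z.
Proof. by case=> _ yx [xz _]; rewrite -[y]mulr1 -xz mulrA yx mul1r. Qed.

Lemma inverseP x : invertible x -> is_inverse x (inverse x).
Proof. exact: (@xgetPex _ 0 (is_inverse x)). Qed.

Lemma inverseE x y : is_inverse x y -> inverse x = y.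
Proof. by move=> xy; apply: (inverse_unique (inverseP _) xy); exists y. Qed.
End Inverse.

Section SymmetricDifference.
Variable I : finType.
Implicit Types A B C : {set I}.

Definition symd A B : {set I} := (A :\: B) :|: (B :\: A).

Lemma in_symd A B x : (x \in symd A B) = (x \in A) (+) (x \in B).
Proof. by rewrite !inE; case: (x \in A); case: (x \in B). Qed.

Lemma symdA A B C : symd A (symd B C) = symd (symd A B) C.
Proof. by apply/setP=> x; rewrite !in_symd addbA. Qed.

Lemma symdC A B : symd A B = symd B A.
Proof. by apply/setP=> x; rewrite !in_symd addbC. Qed.

Lemma symdCA A B C : symd A (symd B C) = symd B (symd A C).
Proof. by rewrite !symdA (symdC A). Qed.

Lemma symdK A : involutive (symd A).
Proof. by move=> B; apply/setP=> x; rewrite !in_symd addKb. Qed.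

Lemma symd0 A : symd A set0 = A.
Proof. by apply/setP=> x; rewrite !in_symd in_set0 addbF. Qed.

Lemma sym0d A : symd set0 A = A.
Proof. by rewrite symdC symd0. Qed.
End SymmetricDifference.

(* For A = {i_1 < ... < i_k} put e_A = e_{i_1} ... e_{i_k}; the e_A form a basis
   of the Clifford algebra and e_A e_B = +/- e_{A symd B}.  Moving each e_j, j in
   B, to the left past the larger e_i, i in A, changes the sign once per such i,
   and a coincidence i = j contributes e_i^2 = -1. *)
Section CliffordSign.
Variables (R : comNzRingType) (n : nat).
Implicit Types A B C : {set 'I_n}.

Definition csgn A B : R := \prod_(i in A) \prod_(j in B | (j <= i)%N) (-1).

Lemma prod_symd (g : 'I_n -> R) A B : (forall i, g i * g i = 1) ->
  \prod_(i in symd A B) g i = (\prod_(i in A) g i) * \prod_(i in B) g i.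
Proof.
move=> g2; rewrite big_mkcond [in RHS]big_mkcond [X in _ * X]big_mkcond.
rewrite -big_split; apply: eq_bigr => i _ /=; rewrite in_symd.
by case: (i \in A); case: (i \in B); rewrite /= ?mulr1 ?mul1r ?g2.
Qed.

Lemma prod_sgn2 (I : finType) (P : pred I) :
  (\prod_(i | P i) (-1 : R)) * \prod_(i | P i) (-1) = 1.
Proof. by rewrite -big_split /= big1 // => i _; rewrite mulrNN mulr1. Qed.

Lemma csgnDl A B C : csgn (symd A B) C = csgn A C * csgn B C.
Proof. by apply: prod_symd => i; exact: prod_sgn2. Qed.

Lemma csgnDr A B C : csgn A (symd B C) = csgn A B * csgn A C.
Proof.
rewrite /csgn -big_split; apply: eq_bigr => i _ /=.
rewrite !big_mkcondr /=; apply: prod_symd => j.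
by case: ifP; rewrite ?mulrNN mulr1.
Qed.

Lemma csgn0l A : csgn set0 A = 1.
Proof. by rewrite /csgn big_set0. Qed.

Lemma csgn0r A : csgn A set0 = 1.
Proof.
by rewrite /csgn big1 // => i _; rewrite big1 // => j; rewrite in_set0.
Qed.

Lemma csgn1 (i j : 'I_n) :
  csgn [set i] [set j] = if (j <= i)%N then -1 else 1.
Proof.
rewrite /csgn big_set1; case: ifP => ji; last first.
  by rewrite big1 // => k /andP[/set1P-> ]; rewrite ji.
rewrite (bigD1 j) /=; last by rewrite set11.
by rewrite big1 ?mulr1 // => k /andP[/andP[/set1P-> _]]; rewrite eqxx.
Qed.
End CliffordSign.
Arguments csgn {R n}.

(* V_n = V (x) R_n, with v = \sum_A v_A (x) e_A stored as the family of its
   components v_A in V, together with the two actions of the Clifford numbers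
   a = \sum_A a_A e_A: since e_B e_{B symd C} = +/- e_C, the component at C of
   a v (resp. v a) collects the terms a_B v_{B symd C}. *)
Section TensorModule.
Variables (R : comNzRingType) (n : nat).
Local Notation coefs := {ffun {set 'I_n} -> R}.

Section Actions.
Variable V : lmodType R.
Local Notation Vn := {ffun {set 'I_n} -> V}.

Definition lact (a : coefs) (v : Vn) : Vn :=
  [ffun C => \sum_B (a B * csgn B (symd B C)) *: v (symd B C)].

Definition ract (v : Vn) (a : coefs) : Vn :=
  [ffun C => \sum_B (a B * csgn (symd B C) B) *: v (symd B C)].

Definition coef1 : coefs := [ffun C => (C == set0)%:R].

Lemma lact1 v : lact coef1 v = v.
Proof.
apply/ffunP=> C; rewrite ffunE (bigD1 set0) //= big1 => [|B /negPf B0].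
  by rewrite ffunE eqxx mul1r csgn0l sym0d scale1r addr0.
by rewrite ffunE B0 mul0r scale0r.
Qed.

Lemma lactDl a b v : lact (a + b) v = lact a v + lact b v.
Proof.
apply/ffunP=> C; rewrite !ffunE -big_split; apply: eq_bigr => B _ /=.
by rewrite !ffunE mulrDl scalerDl.
Qed.

Lemma lactDr a u v : lact a (u + v) = lact a u + lact a v.
Proof.
apply/ffunP=> C; rewrite !ffunE -big_split; apply: eq_bigr => B _ /=.
by rewrite !ffunE scalerDr.
Qed.

Lemma ractDl u v a : ract (u + v) a = ract u a + ract v a.
Proof.
apply/ffunP=> C; rewrite !ffunE -big_split; apply: eq_bigr => B _ /=.
by rewrite !ffunE scalerDr.
Qed.

Lemma ractZl k v a : ract (k *: v) a = k *: ract v a.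
Proof.
apply/ffunP=> C; rewrite !ffunE scaler_sumr; apply: eq_bigr => B _ /=.
by rewrite !ffunE !scalerA mulrC.
Qed.

Lemma lact_ract a v b : ract (lact a v) b = lact a (ract v b).
Proof.
apply/ffunP=> C; rewrite !ffunE.
under eq_bigr do rewrite ffunE scaler_sumr.
under [RHS]eq_bigr do rewrite ffunE scaler_sumr.
rewrite exchange_big /=; apply: eq_bigr => A _; apply: eq_bigr => B _.
rewrite !scalerA (symdCA B A C); congr (_ *: _).
set D := symd A (symd B C).
have -> : symd B C = symd A D by rewrite symdK.
have -> : symd A C = symd B D by rewrite /D (symdCA A B) symdK.
by rewrite csgnDl csgnDr; ring.
Qed.

Definition cscalar (r : R) : coefs := [ffun C => r *+ (C == set0)].

Lemma lact_scalar r v : lact (cscalar r) v = r *: v.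
Proof.
apply/ffunP=> C; rewrite !ffunE (bigD1 set0) //= big1 => [|B /negPf B0].
  by rewrite ffunE eqxx csgn0l sym0d mulr1 addr0.
by rewrite ffunE B0 mul0r scale0r.
Qed.

Lemma ract_scalar r v : ract v (cscalar r) = r *: v.
Proof.
apply/ffunP=> C; rewrite !ffunE (bigD1 set0) //= big1 => [|B /negPf B0].
  by rewrite ffunE eqxx csgn0r sym0d mulr1 addr0.
by rewrite ffunE B0 mul0r scale0r.
Qed.
End Actions.

Definition cmul (a b : coefs) : coefs :=
  [ffun C => \sum_A a A * b (symd A C) * csgn A (symd A C)].

Lemma cmulE a b : cmul a b = lact a (b : {ffun {set 'I_n} -> R^o}).
Proof.
by apply/ffunP=> C; rewrite !ffunE; apply: eq_bigr => A _; rewrite mulrAC.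
Qed.

Lemma lactA (V : lmodType R) a b (v : {ffun {set 'I_n} -> V}) :
  lact (cmul a b) v = lact a (lact b v).
Proof.
apply/ffunP=> C; rewrite !ffunE.
under eq_bigr do rewrite ffunE mulr_suml scaler_suml.
rewrite exchange_big /=; apply: eq_bigr => A _.
rewrite ffunE scaler_sumr (reindex_inj (inv_inj (symdK A))) /=.
apply: eq_bigr => B _; rewrite scalerA symdK -symdA (symdCA A B C).
congr (_ *: _); set D := symd B (symd A C).
have -> : symd A C = symd B D by rewrite symdK.
by rewrite csgnDl csgnDr; ring.
Qed.

Lemma ractA (V : lmodType R) (v : {ffun {set 'I_n} -> V}) a b :
  ract (ract v a) b = ract v (cmul a b).
Proof.
apply/ffunP=> C; rewrite !ffunE.
under [RHS]eq_bigr do rewrite ffunE mulr_suml scaler_suml.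
under [LHS]eq_bigr do rewrite ffunE scaler_sumr.
rewrite exchange_big [RHS]exchange_big /=; apply: eq_bigr => A _.
rewrite [RHS](reindex_inj (inv_inj (symdK A))) /=.
apply: eq_bigr => B _; rewrite scalerA symdK -symdA.
congr (_ *: _); set D := symd A (symd B C).
have -> : symd B C = symd A D by rewrite symdK.
by rewrite csgnDl csgnDr; ring.
Qed.

Lemma cmulA : associative cmul.
Proof. by move=> a b c; rewrite [RHS]cmulE lactA -!cmulE. Qed.

Lemma cmul1l : left_id (coef1 : coefs) cmul.
Proof. by move=> a; rewrite cmulE lact1. Qed.

Lemma cmul1r : right_id (coef1 : coefs) cmul.
Proof.
move=> a; apply/ffunP=> C; rewrite ffunE (bigD1 C) //= big1 => [|A AC].
  have -> : symd C C = set0 by rewrite -[X in symd _ X]symd0 symdK.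
  by rewrite ffunE eqxx mulr1 csgn0r mulr1 addr0.
rewrite ffunE; case: eqP => [E|_]; last by rewrite mulr0 mul0r.
by move: AC; rewrite -[C](symdK A) E symd0 eqxx.
Qed.

Lemma cmulDl : left_distributive cmul +%R.
Proof. by move=> a b c; rewrite !cmulE lactDl. Qed.

Lemma cmulDr : right_distributive cmul +%R.
Proof. by move=> a b c; rewrite !cmulE lactDr. Qed.
End TensorModule.

(* The real Clifford algebra R_n.  The alias hides the pointwise product that
   {ffun _ -> R} carries in the library. *)
Definition clifford (R : comNzRingType) (n : nat) : Type :=
  {ffun {set 'I_n} -> R}.

Section Clifford.
Variables (R : comNzRingType) (n : nat).

HB.instance Definition _ := Choice.copy (clifford R n) {ffun {set 'I_n} -> R}.
HB.instance Definition _ :=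
  GRing.Zmodule.copy (clifford R n) {ffun {set 'I_n} -> R}.
HB.instance Definition _ :=
  GRing.Lmodule.copy (clifford R n) {ffun {set 'I_n} -> R^o}.
HB.instance Definition _ := GRing.Zmodule_isPzRing.Build (clifford R n)
  (@cmulA R n) (@cmul1l R n) (@cmul1r R n) (@cmulDl R n) (@cmulDr R n).

Definition gen (j : 'I_n) : clifford R n := [ffun C => (C == [set j])%:R].

Lemma clifford_mulE (a b : clifford R n) : a * b = cmul a b.
Proof. by []. Qed.

Definition creal (r : R) : clifford R n := r *: (1 : clifford R n).

Lemma cscalarE r : cscalar n r = creal r.
Proof. by apply/ffunP=> C; rewrite !ffunE [RHS]mulr_natr. Qed.

Lemma genM (i j : 'I_n) : gen i * gen j =
  csgn [set i] [set j] *: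
    ([ffun C => (C == symd [set i] [set j])%:R] : clifford R n).
Proof.
rewrite clifford_mulE; apply/ffunP=> C; rewrite ffunE (bigD1 [set i]) //=.
rewrite big1 => [|A /negPf Ai]; last by rewrite ffunE Ai !mul0r.
rewrite !ffunE eqxx mul1r addr0 -{1}(inj_eq (inv_inj (symdK [set i]))) symdK.
rewrite [RHS]mulrC.
by case: eqP => [->|_]; rewrite ?symdK ?mul0r.
Qed.

Lemma gen_sqr (j : 'I_n) : gen j * gen j = - 1 :> clifford R n.
Proof.
rewrite genM csgn1 leqnn scaleN1r; congr (- _); apply/ffunP=> C.
by rewrite !ffunE -[X in symd _ X]symd0 symdK.
Qed.

Lemma gen_anticomm (l m : 'I_n) :
  l != m -> gen l * gen m + gen m * gen l = 0 :> clifford R n.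
Proof.
move=> lm; rewrite !genM (symdC [set m]) !csgn1 -scalerDl.
by case: (ltngtP l m) lm => [||/val_inj->]; rewrite ?eqxx ?addNr ?subrr ?scale0r.
Qed.
End Clifford.
Arguments gen {R n}.

(* Points of R^{n+1} are row vectors (x_0, ..., x_n). *)
Section Paravectors.
Variables (R : realType) (n : nat).
Implicit Types x : 'rV[R]_n.+1.

Definition re_part x : R := x 0 ord0.
Definition vec_part x : 'rV[R]_n := \row_j x 0 (lift ord0 j).
Definition enorm m (u : 'rV[R]_m) : R := Num.sqrt (\sum_j u 0 j ^+ 2).

Definition clvec (u : 'rV[R]_n) : clifford R n := \sum_j u 0 j *: gen j.
Definition paravector x : clifford R n :=
  creal n (re_part x) + clvec (vec_part x).
Definition paravector_conj x : clifford R n :=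
  creal n (re_part x) - clvec (vec_part x).

Definition unit_vectors : set (clifford R n) :=
  [set J | exists2 u : 'rV[R]_n, enorm u = 1 & J = clvec u]%classic.

Definition sphere x : set (clifford R n) :=
  [set z | exists2 J, unit_vectors J &
                      z = creal n (re_part x) + enorm (vec_part x) *: J]%classic.
End Paravectors.

Section Operators.
Variables (R : realType) (V : normedModType R) (n : nat).
Local Notation Vn := {ffun {set 'I_n} -> V}.

(* a Banach norm on V_n inducing the product topology of the components; any
   other such norm is equivalent and gives the same bounded operators *)
Definition tnorm (v : Vn) : R := \sum_A `|v A|.

Definition right_linear (f : Vn -> Vn) :=
  (forall u v, f (u + v) = f u + f v) /\
  (forall v (a : clifford R n), f (ract v a) = ract (f v) a).

Definition bounded_tensor_op (f : Vn -> Vn) :=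
  exists M : R, forall v, tnorm (f v) <= M * tnorm v.

Definition bop_pred : {pred Vn -> Vn} :=
  fun f => `[< right_linear f /\ bounded_tensor_op f >].

Record bop := Bop { bop_fun :> Vn -> Vn; bop_funP : bop_fun \in bop_pred }.

HB.instance Definition _ := [isSub for bop_fun].
HB.instance Definition _ := [Choice of bop by <:].

Lemma normr_csgn (A B : {set 'I_n}) : `|csgn A B : R| = 1.
Proof.
rewrite normr_prod big1 // => i _; rewrite normr_prod big1 // => j _.
by rewrite normrN1.
Qed.

Lemma tnorm_ge0 v : 0 <= tnorm v.
Proof. by apply: sumr_ge0. Qed.

Lemma tnormD u v : tnorm (u + v) <= tnorm u + tnorm v.
Proof.
by rewrite -big_split; apply: ler_sum => A _; rewrite ffunE ler_normD.
Qed.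

Lemma tnormZ k v : tnorm (k *: v) = `|k| * tnorm v.
Proof. by rewrite mulr_sumr; apply: eq_bigr => A _; rewrite ffunE normrZ. Qed.

Lemma bop_submod : submod_closed bop_pred.
Proof.
split=> [|k f g].
  apply/asboolP; split; first split=> [u v|v a] /=.
  - by rewrite addr0.
  - apply/ffunP=> C; rewrite !ffunE big1 // => B _.
    by rewrite ffunE scaler0.
  - exists 0 => v; rewrite mul0r /tnorm big1 // => A _.
    by rewrite ffunE normr0.
move=> /asboolP[[fD fZ] [M fM]] /asboolP[[gD gZ] [N gN]].
apply/asboolP; split; first split=> [u v|v a].
- rewrite -[LHS]/(k *: f (u + v) + g (u + v)) fD gD scalerDr addrACA //.
- rewrite -[LHS]/(k *: f (ract v a) + g (ract v a)) fZ gZ.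
  by rewrite -[RHS]/(ract (k *: f v + g v) a) ractDl ractZl.
exists (`|k| * M + N) => v.
rewrite -[X in tnorm X]/(k *: f v + g v).
rewrite (le_trans (tnormD _ _)) // tnormZ mulrDl -mulrA lerD //.
by rewrite ler_wpM2l.
Qed.

HB.instance Definition _ := GRing.isSubmodClosed.Build _ _ bop_pred bop_submod.
HB.instance Definition _ := [SubChoice_isSubLmodule of bop by <:].

Implicit Types S T : bop.

Lemma bop_eqP S T : (forall v, S v = T v) <-> S = T.
Proof. by split=> [ST|-> //]; apply/val_inj/funext. Qed.

Lemma bop_right_linear T : right_linear T.
Proof. by have /asboolP[] := bop_funP T. Qed.

Lemma bop_bounded T : bounded_tensor_op T.
Proof. by have /asboolP[] := bop_funP T. Qed.

Lemma bopDE S T v : (S + T) v = S v + T v. Proof. by []. Qed.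
Lemma bopZE k T v : (k *: T) v = k *: T v. Proof. by []. Qed.

Lemma bounded_nonneg (f : Vn -> Vn) : bounded_tensor_op f ->
  exists2 M, 0 <= M & forall v, tnorm (f v) <= M * tnorm v.
Proof.
move=> [M fM]; exists `|M| => // v; rewrite (le_trans (fM v)) //.
by rewrite ler_wpM2r ?tnorm_ge0 ?ler_norm.
Qed.

Lemma bop1_subproof : idfun \in bop_pred.
Proof. by apply/asboolP; do 2?split=> //; exists 1 => v; rewrite mul1r. Qed.

Lemma bopM_subproof S T : S \o T \in bop_pred.
Proof.
have [[SD SZ] [TD TZ]] := (bop_right_linear S, bop_right_linear T).
apply/asboolP; split; first split=> [u v|v a] /=; rewrite ?TD ?TZ //.
have [M M0 SM] := bounded_nonneg (bop_bounded S).
have [N N0 TN] := bounded_nonneg (bop_bounded T).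
exists (M * N) => v; rewrite (le_trans (SM _)) // -mulrA.
by rewrite ler_wpM2l.
Qed.

Definition bop1 : bop := Bop bop1_subproof.
Definition bop_comp S T : bop := Bop (bopM_subproof S T).

Fact bop_compA : associative bop_comp.
Proof. by move=> *; apply/bop_eqP. Qed.
Fact bop_comp1l : left_id bop1 bop_comp.
Proof. by move=> *; apply/bop_eqP. Qed.
Fact bop_comp1r : right_id bop1 bop_comp.
Proof. by move=> *; apply/bop_eqP. Qed.
Fact bop_compDl : left_distributive bop_comp +%R.
Proof. by move=> *; apply/bop_eqP. Qed.
Fact bop_compDr : right_distributive bop_comp +%R.
Proof. by move=> S T U; apply/bop_eqP=> v; apply: (bop_right_linear S).1. Qed.

HB.instance Definition _ := GRing.Zmodule_isPzRing.Build bop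
  bop_compA bop_comp1l bop_comp1r bop_compDl bop_compDr.

Lemma bopME S T v : (S * T) v = S (T v). Proof. by []. Qed.

Lemma lact_subproof (a : clifford R n) : lact a \in bop_pred.
Proof.
apply/asboolP; split; first split=> [u v|v b].
- exact: lactDr.
- by rewrite lact_ract.
exists (\sum_B `|a B|) => v; rewrite mulr_suml.
apply: le_trans (_ : \sum_C \sum_B `|a B| * `|v (symd B C)| <= _).
  apply: ler_sum => C _; rewrite ffunE (le_trans (ler_norm_sum _ _ _)) //.
  by apply: ler_sum => B _; rewrite normrZ normrM normr_csgn mulr1.
rewrite exchange_big /=; apply: ler_sum => B _.
by rewrite -mulr_sumr ler_wpM2l // [leRHS](reindex_inj (inv_inj (symdK B))).
Qed.

(* The operator v |-> a v.  Since (a T)(v) = a (T v) and (T a)(v) = T (a v), the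
   products a T and T a are the compositions clop a * T and T * clop a. *)
Definition clop (a : clifford R n) : bop := Bop (lact_subproof a).

Lemma clop_scalar (r : R) T : clop (creal n r) * T = r *: T.
Proof. by apply/bop_eqP=> v; rewrite -cscalarE; apply: lact_scalar. Qed.

Lemma clopM (a b : clifford R n) : clop (a * b) = clop a * clop b.
Proof. by apply/bop_eqP=> v; apply: lactA. Qed.

Definition bounded_op (t : {linear V -> V}) :=
  exists M : R, forall v, `|t v| <= M * `|v|.

Definition compwise (t : {linear V -> V}) (v : Vn) : Vn := [ffun A => t (v A)].

Lemma compwise_subproof t : bounded_op t -> compwise t \in bop_pred.
Proof.
move=> [M tM]; apply/asboolP; split; first split=> [u v|v a].
- by apply/ffunP=> A; rewrite !ffunE linearD.
- apply/ffunP=> A; rewrite !ffunE linear_sum; apply: eq_bigr => B _.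
  by rewrite !ffunE linearZ.
exists M => v; rewrite mulr_sumr; apply: ler_sum => A _.
by rewrite ffunE.
Qed.

Definition extend_op t (tb : bounded_op t) : bop := Bop (compwise_subproof tb).

(* BC^{0,1}(V_n): the paravector operators T_0 + \sum_l e_l T_l with commuting
   bounded components T_0, ..., T_n (which the operator determines) *)
Record bc01 := BC01 {
  component : 'I_n.+1 -> {linear V -> V};
  component_bounded : forall l, bounded_op (component l);
  component_comm : forall l m v,
    component l (component m v) = component m (component l v) }.

Definition component_op (T : bc01) l : bop := extend_op (component_bounded T l).
Definition re_op (T : bc01) : bop := component_op T ord0.
Definition vec_op (T : bc01) : bop :=
  \sum_(j < n) clop (gen j) * component_op T (lift ord0 j).
Definition paravector_op (T : bc01) : bop := re_op T + vec_op T.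
Definition conj_op (T : bc01) : bop := re_op T - vec_op T.
End Operators.
Arguments clop {R V n} a.

Section FResolvent.
Variables (R : realType) (V : normedModType R) (n : nat) (T : bc01 V n).
Implicit Types s p : 'rV[R]_n.+1.
Local Notation scal s := (clop (paravector s) : bop V n).
Local Notation "'T0'" := (re_op T).
Local Notation "'Tv'" := (paravector_op T).
Local Notation "'Tb'" := (conj_op T).

Definition pencil s : bop V n :=
  clop (paravector s ^+ 2) - scal s * (Tv + Tb) + Tv * Tb.

Definition F_resolvent_set : set 'rV[R]_n.+1 :=
  [set s | invertible (pencil s)]%classic.

Definition Qop s : bop V n := inverse (pencil s).

Definition S_L s : bop V n := (scal s - Tb) * Qop s.
Definition S_R s : bop V n := Qop s * (scal s - Tb).

Definition gamma : R := (-1) ^+ (n.-1)./2 * 2 ^+ n.-1 * ((n.-1)./2)`!%:R ^+ 2.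

Definition F_L s : bop V n := gamma *: ((scal s - Tb) * Qop s ^+ (n.+1)./2).
Definition F_R s : bop V n := gamma *: (Qop s ^+ (n.+1)./2 * (scal s - Tb)).

Local Notation h := (n.-1)./2.
Local Notation N := (h.-1)./2.

Definition shift_op (x : 'rV[R]_n.+1) : bop V n :=
  Tv * Tb - (T0 * scal x) *+ 2.

Section Terms.
Variables s p : 'rV[R]_n.+1.
Local Notation S := (scal s).
Local Notation P := (scal p).
Local Notation FR := (F_R s).
Local Notation FL := (F_L p).
Local Notation Us := (shift_op s).
Local Notation Up := (shift_op p).

Definition A0_term : bop V n :=
  - (S ^+ h * FR * Tv * FL * P ^+ h.-1)
  - S ^+ h.-1 * FR * Tv * FL * P ^+ h
  + S ^+ h.-1 * FR * Tv ^+ 2 * FL * P ^+ h.-1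
  + S ^+ h * FR *
    (\sum_(1 <= k < N.+1) (Up ^+ k * FL * P ^+ (h - 2 * k)) *+ 'C(N, k))
  - S ^+ h * FR *
    (\sum_(1 <= k < N.+1) (Up ^+ k * Tv * FL * P ^+ (h - 1 - 2 * k)) *+ 'C(N, k))
  - S ^+ h.-1 * FR *
    (\sum_(1 <= k < N.+1) (Tv * Up ^+ k * FL * P ^+ (h - 2 * k)) *+ 'C(N, k))
  + S ^+ h.-1 * FR *
    (\sum_(1 <= k < N.+1)
        (Tv * Up ^+ k * Tv * FL * P ^+ (h - 1 - 2 * k)) *+ 'C(N, k)).

Definition B0_term : bop V n :=
  (\sum_(1 <= k < N.+1) (S ^+ (h - 2 * k) * FR * Us ^+ k) *+ 'C(N, k)) *
  (\sum_(1 <= k < N.+1) (Up ^+ k * FL * P ^+ (h - 2 * k)) *+ 'C(N, k))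
  - (\sum_(1 <= k < N.+1) (S ^+ (h - 2 * k) * FR * Us ^+ k) *+ 'C(N, k)) *
    (\sum_(1 <= k < N.+1) (Up ^+ k * Tv * FL * P ^+ (h - 1 - 2 * k)) *+ 'C(N, k))
  - (\sum_(1 <= k < N.+1)
        (S ^+ (h - 2 * k - 1) * FR * Tv * Us ^+ k) *+ 'C(N, k)) *
    (\sum_(1 <= k < N.+1) (Up ^+ k * FL * P ^+ (h - 2 * k)) *+ 'C(N, k))
  + (\sum_(1 <= k < N.+1)
        (S ^+ (h - 2 * k - 1) * FR * Tv * Us ^+ k) *+ 'C(N, k)) *
    (\sum_(1 <= k < N.+1)
        (Up ^+ k * Tv * FL * P ^+ (h - 1 - 2 * k)) *+ 'C(N, k)).

Definition C0_term : bop V n :=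
  (\sum_(1 <= k < N.+1) (S ^+ (h - 2 * k) * FR * Us ^+ k) *+ 'C(N, k)) *
    FL * P ^+ h
  - (\sum_(1 <= k < N.+1) (S ^+ (h - 2 * k) * FR * Us ^+ k * Tv) *+ 'C(N, k)) *
    FL * P ^+ h.-1
  - (\sum_(1 <= k < N.+1)
        (S ^+ (h - 1 - 2 * k) * FR * Tv * Us ^+ k) *+ 'C(N, k)) *
    FL * P ^+ h
  + (\sum_(1 <= k < N.+1)
        (S ^+ (h - 1 - 2 * k) * FR * Tv * Us ^+ k * Tv) *+ 'C(N, k)) *
    FL * P ^+ h.-1.
End Terms.
End FResolvent.
Arguments gamma : clear implicits.

(* Main.v *)
Require Import Defs.
From HB Require Import structures.
From mathcomp Require Import all_boot all_order all_algebra.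
From mathcomp Require Import boolp classical_sets functions reals normedtype.
From mathcomp Require Import ring.

(** Put B = S_R(s), C = S_L(p), and write Qs, Qp for the inverses of the two
    pencils, S, P for the operators of left multiplication by s and p, and
    N = (h - 1) / 2.

    Since the components of T commute with each other and with Clifford
    numbers, T + Tbar = 2 T_0 and T Tbar = sum_l T_l^2 commute with s, and the
    pencil factors as s (s - Tbar) - (s - Tbar) T.  Hence the resolvent
    equations S B - B T = 1 and C P - T C = 1, and, with g = gamma_n,
    R = F^R(s) = g Qs^h B and L = F^L(p) = g C Qp^h, also S R - R T = g Qs^h
    and L P - T L = g Qp^h.

    The pencil of s is S^2 + U with U = |T|^2 - 2 T_0 S.  The expression
    s^h R L p^h + A0 + B0 + C0 is the expansion of
      (sum_k binom(N,k) S^(2(N-k)) (S R - R T) U^k)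
      (sum_l binom(N,l) W^l (L P - T L) P^(2(N-l))),
    W being the analogue of U for p ([binomial_tail]).  By the resolvent
    equations and the binomial theorem it is g^2 pencil(s)^N Qs^h Qp^h
    pencil(p)^N = g^2 Qs^(N+1) Qp^(N+1), and divided by g it is the term missing
    from the last sum of the theorem ([binomial_part_eq]).  The whole left side
    is therefore g Y with
      Y = sum_(j <= h) Qs^(h-j) B C Qp^j + sum_(i < h) Qs^(h-i) Qp^(i+1)
    ([resolvent_products]), and a telescoping sum gives
    Y P - S Y = Qs^h B - C Qp^h, that is (R - L) / g ([sylvester_telescope]).

    Right multiplication by c = p^2 - 2 s_0 p + |s|^2 sends x to
    y P - Sbar y with y = x P - S x ([mulr_sphere_denominator]), so the left
    side times c is (R - L) p - sbar (R - L).  Finally c is invertible because s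
    is not on the sphere of p ([sphere_denominator_invertible]). *)

Set Implicit Arguments.
Unset Strict Implicit.
Unset Printing Implicit Defensive.

Import Order.TTheory GRing.Theory Num.Theory.
Local Open Scope ring_scope.

(** * Identities in noncommutative rings *)

Section RingIdentities.
Variable A : pzRingType.
Implicit Types x y : A.

(** Both the squared norm of a vector of the Clifford algebra and the scalar
    nature of the square of a vector operator come from this cancellation of
    cross terms. *)
Lemma sqr_sum_anticomm (I : eqType) (r : seq I) (a : I -> A) : uniq r ->
  (forall i j, i != j -> a i * a j + a j * a i = 0) ->
  (\sum_(i <- r) a i) ^+ 2 = \sum_(i <- r) a i ^+ 2.
Proof.
move=> + anti; elim: r => [|i r IH] /=; first by rewrite !big_nil expr2 mulr0.
case/andP=> ir /IH {}IH; rewrite !big_cons -IH !expr2 mulrDl !mulrDr.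
rewrite addrA -(addrA (a i * a i)) mulr_sumr mulr_suml -big_split /=.
rewrite big1_seq ?addr0 // => j /andP[_ jr]; apply: anti.
by apply: contraNneq ir => ->.
Qed.

Lemma mulrBB x1 x2 y1 y2 :
  (x1 - x2) * (y1 - y2) = x1 * y1 - x1 * y2 - x2 * y1 + x2 * y2.
Proof. by rewrite mulrBl !mulrBr opprB addrA addrAC. Qed.

Lemma comm_inverse x y :
  invertible y -> GRing.comm x y -> GRing.comm x (inverse y).
Proof.
move=> /inverseP[yz zy] xy; rewrite /GRing.comm.
by rewrite -[LHS]mul1r -{1}zy -!mulrA [y * _]mulrA -xy -mulrA yz mulr1.
Qed.

(** The case without powers of the pencil: both halves of the difference
    contain B T C, which cancels. *)
Lemma sylvester_product (S P T B C : A) :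
  S * B - B * T = 1 -> C * P - T * C = 1 ->
  B * C * P - S * (B * C) = B - C.
Proof.
move=> eqB eqC.
have -> : S * (B * C) = C + B * T * C.
  by rewrite mulrA -[S * B](subrK (B * T)) eqB mulrDl mul1r.
rewrite -mulrA -[C * P](subrK (T * C)) eqC mulrDr mulr1 mulrA.
by rewrite opprD addrACA subrr addr0.
Qed.

(** A term of the first sum is sent by Y |-> Y P - S Y to
    Qs^(m-j) (B - C) Qp^j, whose two halves for consecutive j differ by
    Qs^(m-j) (S - P) Qp^(j+1): the image of the second sum cancels
    exactly these differences, and only the two end terms survive. *)
Lemma sylvester_telescope (S P T D Qs Qp : A) (m : nat) :
  let B := Qs * (S - D) in let C := (P - D) * Qp in
  GRing.comm S Qs -> GRing.comm P Qp ->
  S * B - B * T = 1 -> C * P - T * C = 1 ->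
  let Y := \sum_(0 <= j < m.+1) Qs ^+ (m - j) * (B * C) * Qp ^+ j
           + \sum_(0 <= i < m) Qs ^+ (m - i) * Qp ^+ (i + 1) in
  Y * P - S * Y = Qs ^+ m * B - C * Qp ^+ m.
Proof.
move=> B C SQ PQ eqB eqC Y.
have BC := sylvester_product eqB eqC.
have delta k l x : Qs ^+ k * x * Qp ^+ l * P - S * (Qs ^+ k * x * Qp ^+ l)
    = Qs ^+ k * (x * P - S * x) * Qp ^+ l.
  rewrite -[LHS]/(_ - _) -mulrA -(commrX l PQ) mulrBr mulrBl !mulrA.
  by rewrite (commrX k SQ).
rewrite {}/Y mulrDl mulrDr opprD addrACA !mulr_suml !mulr_sumr -!sumrB.
under eq_bigr do rewrite delta BC mulrBr mulrBl.
under [X in _ + X]eq_bigr=> i _.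
  rewrite -[Qs ^+ _]mulr1 delta mul1r mulr1.
  over.
rewrite sumrB big_nat_recl // [X in _ - X + _]big_nat_recr //=.
rewrite subn0 subnn expr0 mul1r mulr1.
pose Z := \sum_(0 <= i < m) Qs ^+ (m - i.+1) * B * Qp ^+ i.+1.
pose W := \sum_(0 <= i < m) Qs ^+ (m - i) * C * Qp ^+ i.
have -> : \sum_(0 <= i < m) Qs ^+ (m - i) * (P - S) * Qp ^+ (i + 1) = W - Z.
  rewrite -sumrB; apply: eq_big_nat => i /andP[_ im].
  rewrite addn1 -[(m - i)%N]subnSK // [Qs ^+ _.+1]exprSr [Qp ^+ _.+1]exprS.
  rewrite /B /C -[P - S](addrKA (- D)) [- D + S]addrC.
  by move: (P - D) (S - D) => x y; rewrite mulrBr mulrBl !mulrA.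
rewrite -/Z -/W opprD (addrACA _ Z) (addrACA _ _ W) subrK; congr (_ + _).
by rewrite addrAC subrr add0r.
Qed.
End RingIdentities.

(** * The quadratic denominator in the Clifford algebra *)

Section CliffordNorm.
Variables (R : realType) (n : nat).
Local Notation Cl := (clifford R n).

Lemma creal_mull (r : R) (a : Cl) : creal n r * a = r *: a.
Proof. by rewrite -cscalarE clifford_mulE cmulE lact_scalar. Qed.

Lemma clifford_scalerAl (r : R) (a b : Cl) : r *: (a * b) = (r *: a) * b.
Proof. by rewrite -!creal_mull mulrA. Qed.

Lemma clifford_scalerAr (r : R) (a b : Cl) : r *: (a * b) = a * (r *: b).
Proof.
rewrite !clifford_mulE; apply/ffunP=> C; rewrite !ffunE scaler_sumr.
apply: eq_bigr => B _; rewrite !ffunE /GRing.scale /=.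
by rewrite !mulrA [r * _]mulrC.
Qed.

Lemma clvec_sqr (u : 'rV[R]_n) :
  clvec u ^+ 2 = - creal n (\sum_j u 0 j ^+ 2).
Proof.
rewrite sqr_sum_anticomm ?index_enum_uniq // => [|i j ij]; last first.
  rewrite -!(clifford_scalerAl, clifford_scalerAr) !scalerA [u 0 j * _]mulrC.
  by rewrite -scalerDr gen_anticomm ?scaler0.
rewrite /creal scaler_suml -sumrN; apply: eq_bigr => j _.
by rewrite expr2 -clifford_scalerAl -clifford_scalerAr scalerA gen_sqr scalerN.
Qed.

Lemma clvecZ k (u : 'rV[R]_n) : clvec (k *: u) = k *: clvec u.
Proof.
by rewrite /clvec scaler_sumr; apply: eq_bigr => j _; rewrite mxE scalerA.
Qed.

Lemma enorm_sqr m (u : 'rV[R]_m) : enorm u ^+ 2 = \sum_j u 0 j ^+ 2.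
Proof. by rewrite sqr_sqrtr // sumr_ge0 // => j _; rewrite sqr_ge0. Qed.

Lemma enorm_ge0 m (u : 'rV[R]_m) : 0 <= enorm u.
Proof. exact: sqrtr_ge0. Qed.

Lemma enormZ m k (u : 'rV[R]_m) : 0 <= k -> enorm (k *: u) = k * enorm u.
Proof.
move=> k0; apply/eqP; rewrite -(@eqrXn2 _ 2) ?mulr_ge0 ?enorm_ge0 //.
rewrite exprMn !enorm_sqr mulr_sumr; apply/eqP/eq_bigr => j _.
by rewrite mxE exprMn.
Qed.

Lemma enorm_paravector_sqr (x : 'rV[R]_n.+1) :
  enorm x ^+ 2 = re_part x ^+ 2 + enorm (vec_part x) ^+ 2.
Proof.
rewrite !enorm_sqr big_ord_recl; congr (_ + _).
by apply: eq_bigr => j _; rewrite mxE.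
Qed.

Lemma paravectorE (x : 'rV[R]_n.+1) :
  paravector x = re_part x *: (1 : Cl) + clvec (vec_part x).
Proof. by []. Qed.

(** The plane spanned by 1 and a vector u is a commutative subalgebra, which
    reduces all computations with one paravector to those with complex
    numbers. *)
Lemma scaled_clvec_mul (a b c d : R) (u : 'rV[R]_n) :
  (a *: (1 : Cl) + b *: clvec u) * (c *: (1 : Cl) + d *: clvec u)
  = (a * c - b * d * enorm u ^+ 2) *: (1 : Cl) + (a * d + b * c) *: clvec u.
Proof.
rewrite !mulrDl !mulrDr -!(clifford_scalerAl, clifford_scalerAr) !scalerA.
rewrite !(mul1r, mulr1) -expr2 clvec_sqr -enorm_sqr /creal -scaleNr scalerA.
by rewrite mulrN [X in _ + X]addrC addrACA -!scalerDl.
Qed.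

Lemma paravector_conj_mul (x : 'rV[R]_n.+1) :
  paravector_conj x * paravector x = creal n (enorm x ^+ 2).
Proof.
have := scaled_clvec_mul (re_part x) (- 1) (re_part x) 1 (vec_part x).
rewrite scale1r scaleN1r => /= ->.
rewrite !(mulr1, mul1r, mulrN, mulN1r) subrr scale0r addr0 opprK.
by rewrite enorm_paravector_sqr.
Qed.

Lemma paravector_conjD (x : 'rV[R]_n.+1) :
  paravector x + paravector_conj x = (2 * re_part x) *: (1 : Cl).
Proof.
rewrite /paravector /paravector_conj addrACA subrr addr0 -scalerDl.
by rewrite mulr_natl mulr2n.
Qed.

(** When the vector part of s vanishes, any unit vector is a witness; one
    exists because n > 0. *)
Lemma sphere_eq_re_norm (p s : 'rV[R]_n.+1) : (0 < n)%N ->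
  re_part s = re_part p -> enorm (vec_part s) = enorm (vec_part p) ->
  sphere p (paravector s).
Proof.
move=> n0 re_eq norm_eq; set v := vec_part s.
rewrite /sphere /= -norm_eq -re_eq -/v.
have [v0|v0] := eqVneq (enorm v) 0; last first.
  exists (clvec ((enorm v)^-1 *: v)); last first.
    by rewrite clvecZ scalerA divff // scale1r.
  exists ((enorm v)^-1 *: v) => //.
  by rewrite enormZ ?invr_ge0 ?enorm_ge0 // mulVf.
pose j0 : 'I_n := Ordinal n0; pose u : 'rV[R]_n := delta_mx 0 j0.
exists (clvec u).
  exists u => //; apply/eqP; rewrite -(@eqrXn2 _ 2) ?enorm_ge0 ?ler01 //.
  rewrite enorm_sqr (bigD1 j0) //= big1 => [|j /negPf jj0].
    by rewrite mxE !eqxx addr0.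
  by rewrite mxE jj0 andbF expr2 mulr0.
rewrite v0 scale0r /paravector -/v; congr (_ + _).
rewrite /clvec big1 // => j _; suff -> : v 0 j = 0 by rewrite scale0r.
have /eqP : enorm v ^+ 2 = 0 by rewrite v0 expr2 mulr0.
rewrite enorm_sqr psumr_eq0 => [/allP /(_ j)|k _]; last exact: sqr_ge0.
by rewrite mem_index_enum sqrf_eq0 => /(_ isT) /eqP.
Qed.

(** The element lies in the plane spanned by 1 and the vector part of p, so it
    is invertible unless it is 0, as for complex numbers; and it is 0 only if s
    and p have the same real part and vector parts of equal length. *)
Lemma sphere_denominator_invertible (p s : 'rV[R]_n.+1) : (0 < n)%N ->
  ~ sphere p (paravector s) ->
  invertible (paravector p ^+ 2 - (2 * re_part s) *: paravector p
              + creal n (enorm s ^+ 2)).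
Proof.
move=> n0 sp; set w := enorm (vec_part p); set u := enorm (vec_part s).
pose b := 2 * (re_part p - re_part s).
pose a := (re_part p - re_part s) ^+ 2 + u ^+ 2 - w ^+ 2.
have -> : paravector p ^+ 2 - (2 * re_part s) *: paravector p
    + creal n (enorm s ^+ 2) = a *: (1 : Cl) + b *: clvec (vec_part p).
  have := scaled_clvec_mul (re_part p) 1 (re_part p) 1 (vec_part p).
  rewrite scale1r -paravectorE => /= sqr; rewrite expr2 [_ * _]sqr -/w.
  rewrite paravectorE scalerDr scalerA enorm_paravector_sqr /creal -/u.
  rewrite opprD addrACA -!scaleNr -!scalerDl addrAC -scalerDl.
  by congr (_ *: _ + _ *: _); rewrite /a /b; ring.
(* a^2 + (b w)^2 is the squared modulus of a + b v, where v, the vector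
   part of p, has square - w^2. *)
have nz : a ^+ 2 + (b * w) ^+ 2 != 0.
  apply: contra_notN sp; rewrite paddr_eq0 ?sqr_ge0 // !sqrf_eq0 mulf_eq0.
  case/andP=> /eqP a0 /orP bw.
  suff [re_eq wu] : re_part s = re_part p /\ u ^+ 2 = w ^+ 2.
    apply: sphere_eq_re_norm => //; apply/eqP.
    by rewrite -(@eqrXn2 _ 2) ?enorm_ge0 // wu.
  case: bw => /eqP.
    move/eqP; rewrite mulf_eq0 pnatr_eq0 /= subr_eq0 => /eqP re_eq.
    by split=> //; apply/eqP; rewrite -subr_eq0 -a0 /a re_eq subrr expr0n add0r.
  move=> w0; move/eqP: a0; rewrite /a w0 expr0n subr0.
  rewrite paddr_eq0 ?sqr_ge0 // !sqrf_eq0 subr_eq0.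
  by case/andP=> /eqP-> /eqP->; rewrite expr2 mulr0.
set N := a ^+ 2 + _ in nz.
exists ((N^-1 * a) *: (1 : Cl) + (- (N^-1 * b)) *: clvec (vec_part p)).
have one : (1 : Cl) = 1 *: (1 : Cl) + 0 *: clvec (vec_part p).
  by rewrite scale1r scale0r addr0.
by split; rewrite scaled_clvec_mul [RHS]one; congr (_ *: _ + _ *: _);
  rewrite -/w ?[RHS](esym (mulVf nz)) /N; ring.
Qed.

End CliffordNorm.

(** * Clifford numbers and components as operators *)

Section CliffordOperators.
Variables (R : realType) (V : normedModType R) (n : nat).
Local Notation B := (bop V n).
Implicit Types (a : clifford R n) (x y : B).

Lemma clopD a b : clop (a + b) = clop a + clop b :> B.
Proof. by apply/bop_eqP=> v; apply: lactDl. Qed.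

Lemma clop1 : clop 1 = 1 :> B.
Proof. by apply/bop_eqP=> v; apply: lact1. Qed.

Lemma clopZ (r : R) a : clop (r *: a) = r *: clop a :> B.
Proof. by rewrite -creal_mull clopM clop_scalar. Qed.

Lemma clopX a k : clop (a ^+ k) = clop a ^+ k :> B.
Proof. by elim: k => [|k IH]; rewrite ?clop1 // !exprS clopM IH. Qed.

Lemma bop_scalerAl (r : R) x y : r *: (x * y) = (r *: x) * y.
Proof. by apply/bop_eqP. Qed.

Lemma bop_scalerAr (r : R) x y : r *: (x * y) = x * (r *: y).
Proof.
apply/bop_eqP=> v; rewrite bopME !bopZE bopME -!(ract_scalar r).
by have [_ <-] := bop_right_linear x.
Qed.

Variable T : bc01 V n.

Lemma component_clop_comm l a : GRing.comm (component_op T l) (clop a).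
Proof.
apply/bop_eqP=> v; apply/ffunP=> C; rewrite !ffunE linear_sum.
by apply: eq_bigr => A _; rewrite linearZ ffunE.
Qed.

Lemma component_op_comm l m : GRing.comm (component_op T l) (component_op T m).
Proof.
by apply/bop_eqP=> v; apply/ffunP=> C; rewrite !ffunE component_comm.
Qed.

(** The square involves the components only, no Clifford unit; this is what
    makes T Tbar, and hence the pencil of s, commute with s. *)
Lemma vec_op_sqr :
  vec_op T ^+ 2 = - \sum_(j < n) component_op T (lift ord0 j) ^+ 2.
Proof.
pose t j := component_op T (lift ord0 j).
have mulE i j : clop (gen i) * t i * (clop (gen j) * t j)
    = clop (gen i * gen j) * (t i * t j).
  rewrite clopM -!mulrA; congr (_ * _).
  by rewrite !mulrA; congr (_ * _); apply: component_clop_comm.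
rewrite /vec_op sqr_sum_anticomm ?index_enum_uniq // => [|i j ij]; last first.
  rewrite !mulE [t j * _]component_op_comm -mulrDl -clopD.
  by rewrite gen_anticomm // -[0](scale0r 0) clopZ -bop_scalerAl !scale0r.
rewrite -sumrN; apply: eq_bigr => j _.
by rewrite expr2 mulE gen_sqr -scaleN1r clopZ clop1 scaleN1r mulN1r.
Qed.

Lemma re_op_vec_comm : GRing.comm (re_op T) (vec_op T).
Proof.
by apply: commr_sum => j _; apply: commrM;
  [exact: component_clop_comm | exact: component_op_comm].
Qed.

Lemma paravector_op_conjD : paravector_op T + conj_op T = re_op T *+ 2.
Proof.
by rewrite /paravector_op /conj_op addrACA subrr addr0 mulr2n.
Qed.

Lemma conj_paravector_comm : GRing.comm (conj_op T) (paravector_op T).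
Proof.
have c0 := re_op_vec_comm.
by apply: commrD; apply: commr_sym; apply: commrB => //; apply: commr_sym.
Qed.

Lemma normsq_op_sum :
  paravector_op T * conj_op T = \sum_(l < n.+1) component_op T l ^+ 2.
Proof.
rewrite /paravector_op /conj_op mulrBr !mulrDl -re_op_vec_comm -!expr2.
by rewrite opprD addrA addrK vec_op_sqr opprK big_ord_recl.
Qed.

Lemma normsq_op_comm x : (forall l, GRing.comm x (component_op T l)) ->
  GRing.comm x (paravector_op T * conj_op T).
Proof.
by move=> xT; rewrite normsq_op_sum; apply: commr_sum => l _; exact: commrX.
Qed.

End CliffordOperators.

(** * The F-resolvent operators *)

Section FResolventTerms.
Variables (R : realType) (V : normedModType R) (n : nat) (T : bc01 V n).
Implicit Types s p : 'rV[R]_n.+1.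
Local Notation scal s := (clop (paravector s) : bop V n).
Local Notation Tv := (paravector_op T).
Local Notation Tb := (conj_op T).
Local Notation g := (gamma R n).
Local Notation h := (n.-1)./2.
Local Notation N := (h.-1)./2.

Lemma gamma_neq0 : g != 0.
Proof.
apply: mulf_neq0; first apply: mulf_neq0; apply: expf_neq0.
- by rewrite oppr_eq0 oner_eq0.
- by rewrite pnatr_eq0.
- by rewrite pnatr_eq0 -lt0n fact_gt0.
Qed.

Lemma scal_re_comm s : GRing.comm (scal s) (re_op T).
Proof. exact/commr_sym/component_clop_comm. Qed.

Lemma scal_normsq_comm s : GRing.comm (scal s) (Tv * Tb).
Proof. by apply: normsq_op_comm => l; exact/commr_sym/component_clop_comm. Qed.

Lemma scal_shift_comm s : GRing.comm (scal s) (shift_op T s).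
Proof.
apply: commrB; first exact: scal_normsq_comm.
by apply: commrMn; apply: commrM => //; exact: scal_re_comm.
Qed.

Lemma pencil_shift s : pencil T s = scal s ^+ 2 + shift_op T s.
Proof.
rewrite /pencil /shift_op paravector_op_conjD clopX mulrnAr scal_re_comm.
by rewrite addrA addrAC.
Qed.

Lemma scal_Q_comm s : F_resolvent_set T s -> GRing.comm (scal s) (Qop T s).
Proof.
move=> sT; apply: comm_inverse => //; rewrite pencil_shift.
by apply: commrD; [exact: commrX | exact: scal_shift_comm].
Qed.

Lemma shift_Q_comm s : F_resolvent_set T s ->
  GRing.comm (shift_op T s) (Qop T s).
Proof.
move=> sT; apply: comm_inverse => //; rewrite pencil_shift.
by apply: commrD => //; apply: commrX; exact/commr_sym/scal_shift_comm.
Qed.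

Lemma pencil_factor_right s :
  scal s * (scal s - Tb) - (scal s - Tb) * Tv = pencil T s.
Proof.
have := conj_paravector_comm T; rewrite /pencil clopX expr2.
move: Tv Tb => t u ut; rewrite mulrBr mulrBl ut mulrDr.
by rewrite opprB opprD !addrA addrAC [in RHS]addrAC.
Qed.

Lemma pencil_factor_left p :
  (scal p - Tb) * scal p - Tv * (scal p - Tb) = pencil T p.
Proof.
have comm2 : scal p * (Tv + Tb) = Tv * scal p + Tb * scal p.
  rewrite -mulrDl paravector_op_conjD.
  by apply: commrMn; exact: scal_re_comm.
rewrite /pencil comm2 clopX expr2; move: Tv Tb => t u.
by rewrite mulrBr mulrBl opprB opprD !addrA addrAC [in RHS]addrAC.
Qed.

(** Since s commutes with its pencil, it passes through its inverse, and the
    factorization of the pencil applies. *)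
Lemma S_R_eq s : F_resolvent_set T s -> scal s * S_R T s - S_R T s * Tv = 1.
Proof.
move=> sT; rewrite /S_R mulrA scal_Q_comm // -!mulrA -mulrBr.
by rewrite pencil_factor_right; have [_ ->] := inverseP sT.
Qed.

Lemma S_L_eq p : F_resolvent_set T p -> S_L T p * scal p - Tv * S_L T p = 1.
Proof.
move=> pT; rewrite /S_L -mulrA -scal_Q_comm // !mulrA -mulrBl.
by rewrite pencil_factor_left; have [-> _] := inverseP pT.
Qed.

(** Right multiplication by the denominator is the composite of the two
    commuting maps Y |-> Y p - s Y and Y |-> Y p - sbar Y, because s + sbar and
    s sbar are real. *)
Lemma mulr_sphere_denominator (x : bop V n) s p :
  let y := x * scal p - scal s * x in
  x * clop (paravector p ^+ 2 - (2 * re_part s) *: paravector p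
            + creal n (enorm s ^+ 2))
  = y * scal p - clop (paravector_conj s) * y.
Proof.
move=> y; have norm : clop (paravector_conj s) * scal s
    = enorm s ^+ 2 *: (1 : bop V n).
  by rewrite -clopM paravector_conj_mul clopZ clop1.
have tr : scal s + clop (paravector_conj s) = (2 * re_part s) *: (1 : bop V n).
  by rewrite -clopD paravector_conjD clopZ clop1.
have -> : clop (paravector p ^+ 2 - (2 * re_part s) *: paravector p
      + creal n (enorm s ^+ 2))
    = scal p ^+ 2 - (2 * re_part s) *: scal p + enorm s ^+ 2 *: (1 : bop V n).
  rewrite (@clopD _ _ _ (_ - _)) (@clopD _ _ _ (_ ^+ 2)) clopX -scaleNr.
  by rewrite !clopZ clop1 scaleNr.
rewrite {}/y; move: (scal s) (scal p) (clop (paravector_conj s)) norm tr.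
move=> S P Sb norm tr; rewrite mulrDr mulrBr -!bop_scalerAr mulr1.
have -> : (2 * re_part s) *: (x * P) = S * (x * P) + Sb * (x * P).
  by rewrite -mulrDl tr -bop_scalerAl mul1r.
have -> : enorm s ^+ 2 *: x = Sb * (S * x).
  by rewrite mulrA norm -bop_scalerAl mul1r.
by rewrite mulrBl mulrBr opprB opprD expr2 !mulrA !addrA [RHS]addrAC.
Qed.

Hypothesis n_odd : odd n.

Lemma half_succ_odd : (n.+1)./2 = h.+1.
Proof. by case: n n_odd. Qed.

Lemma F_R_S_R s : F_R T s = g *: (Qop T s ^+ h * S_R T s).
Proof. by rewrite /F_R half_succ_odd exprSr mulrA. Qed.

Lemma F_L_S_L p : F_L T p = g *: (S_L T p * Qop T p ^+ h).
Proof. by rewrite /F_L half_succ_odd exprS mulrA. Qed.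

(** The F-resolvent counterpart of [S_R_eq]: a power of the inverse pencil takes
    the place of 1, and it commutes with s and with the shift operator of s,
    while R itself does not. *)
Lemma F_R_eq s : F_resolvent_set T s ->
  scal s * F_R T s - F_R T s * Tv = g *: Qop T s ^+ h.
Proof.
move=> sT; rewrite F_R_S_R -bop_scalerAr -bop_scalerAl -scalerBr.
move: (S_R T s) (S_R_eq sT) => x eqx.
by rewrite mulrA (commrX h (scal_Q_comm sT)) -!mulrA -mulrBr eqx mulr1.
Qed.

Lemma F_L_eq p : F_resolvent_set T p ->
  F_L T p * scal p - Tv * F_L T p = g *: Qop T p ^+ h.
Proof.
move=> pT; rewrite F_L_S_L -bop_scalerAr -bop_scalerAl -scalerBr.
move: (S_L T p) (S_L_eq pT) => x eqx.
by rewrite -mulrA -(commrX h (scal_Q_comm pT)) !mulrA -mulrBl eqx mul1r.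
Qed.

Hypothesis h_odd : odd h.

Let half_eq : h = (2 * N).+1.
Proof. by rewrite mul2n; case: h h_odd => // k /= /even_halfK->. Qed.

Lemma binomial_pencil_Q s : F_resolvent_set T s ->
  (scal s ^+ 2 + shift_op T s) ^+ N * Qop T s ^+ h = Qop T s ^+ N.+1.
Proof.
move=> sT; rewrite -pencil_shift.
have [pQ Qp] := inverseP sT.
move: N half_eq => M ->; rewrite mul2n -addnn -addnS.
by rewrite exprD mulrA -exprMn_comm ?pQ ?expr1n ?mul1r // /GRing.comm pQ Qp.
Qed.

(** Expanding the product of the two binomial sums, with the terms k = 0 set
    apart, splits it into four parts: both k and l zero gives the leading term
    and the first three terms of A0, k = 0 < l the other terms of A0, k, l > 0
    gives B0, and l = 0 < k gives C0.  The shift operators do not commute with R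
    and L; having that of s to the right of R T or R, and that of p to the left
    of T L or L, lets R and L combine into X and Y first. *)
Lemma binomial_tail s p :
  let X := scal s * F_R T s - F_R T s * Tv in
  let Y := F_L T p * scal p - Tv * F_L T p in
  scal s ^+ h * F_R T s * F_L T p * scal p ^+ h
    + A0_term T s p + B0_term T s p + C0_term T s p
  = (\sum_(0 <= k < N.+1)
       (scal s ^+ (2 * (N - k)) * X * shift_op T s ^+ k) *+ 'C(N, k))
    * (\sum_(0 <= k < N.+1)
       (shift_op T p ^+ k * Y * scal p ^+ (2 * (N - k))) *+ 'C(N, k)).
Proof.
move=> X Y; rewrite /A0_term /B0_term /C0_term.
have e1 k : (k < N.+1)%N -> (h - 2 * k)%N = (2 * (N - k)).+1.
  by move=> kN; rewrite {1}half_eq mulnBr subSn // leq_mul2l.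
have e2 k : (h - 2 * k - 1)%N = (2 * (N - k))%N.
  by rewrite {1}half_eq mulnBr subnAC subn1.
have e3 k : (h - 1 - 2 * k)%N = (2 * (N - k))%N.
  by rewrite -e2 subnAC.
have e4 : h.-1 = (2 * (N - 0))%N by rewrite subn0 {1}half_eq.
rewrite {}/X {}/Y; move: (shift_op T s) (shift_op T p) => U W.
move: (F_R T s) (F_L T p) (scal s) (scal p) => F G S P.
pose a := \sum_(1 <= k < N.+1) (S ^+ (h - 2 * k) * F * U ^+ k) *+ 'C(N, k).
pose d := \sum_(1 <= k < N.+1)
  (S ^+ (h - 2 * k - 1) * F * Tv * U ^+ k) *+ 'C(N, k).
pose b := \sum_(1 <= k < N.+1) (W ^+ k * G * P ^+ (h - 2 * k)) *+ 'C(N, k).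
pose c := \sum_(1 <= k < N.+1)
  (W ^+ k * Tv * G * P ^+ (h - 1 - 2 * k)) *+ 'C(N, k).
(* The k = 0 term is split off, and 2 (N - k) + 1 = h - 2 k. *)
have ad : \sum_(0 <= k < N.+1)
    (S ^+ (2 * (N - k)) * (S * F - F * Tv) * U ^+ k) *+ 'C(N, k)
    = (S ^+ h * F - S ^+ h.-1 * F * Tv) + (a - d).
  rewrite big_ltn // bin0 expr0 mulr1 -e4 mulrBr !mulrA -exprSr.
  rewrite prednK ?odd_gt0 //.
  congr (_ + _); rewrite -sumrB; apply: eq_big_nat => k /andP[_ kN].
  by rewrite e2 e1 // -mulrnBl -mulrBl mulrBr !mulrA -exprSr.
have bc : \sum_(0 <= k < N.+1)
    (W ^+ k * (G * P - Tv * G) * P ^+ (2 * (N - k))) *+ 'C(N, k)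
    = (G * P ^+ h - Tv * G * P ^+ h.-1) + (b - c).
  rewrite big_ltn // bin0 expr0 mul1r -e4 mulrBl -!mulrA -exprS.
  rewrite prednK ?odd_gt0 //.
  rewrite !mulrA; congr (_ + _); rewrite -sumrB.
  apply: eq_big_nat => k /andP[_ kN].
  by rewrite e3 e1 // -mulrnBl mulrBr mulrBl exprS !mulrA.
have -> : \sum_(1 <= k < N.+1) (Tv * W ^+ k * G * P ^+ (h - 2 * k)) *+ 'C(N, k)
    = Tv * b.
  by rewrite mulr_sumr; apply: eq_bigr => k _; rewrite mulrnAr !mulrA.
have -> : \sum_(1 <= k < N.+1)
    (Tv * W ^+ k * Tv * G * P ^+ (h - 1 - 2 * k)) *+ 'C(N, k) = Tv * c.
  by rewrite mulr_sumr; apply: eq_bigr => k _; rewrite mulrnAr !mulrA.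
have -> : \sum_(1 <= k < N.+1) (S ^+ (h - 2 * k) * F * U ^+ k * Tv) *+ 'C(N, k)
    = a * Tv.
  by rewrite mulr_suml; apply: eq_bigr => k _; rewrite mulrnAl.
have -> : \sum_(1 <= k < N.+1)
    (S ^+ (h - 1 - 2 * k) * F * Tv * U ^+ k * Tv) *+ 'C(N, k) = d * Tv.
  by rewrite mulr_suml; apply: eq_bigr => k _; rewrite mulrnAl e2 e3.
have -> : \sum_(1 <= k < N.+1)
    (S ^+ (h - 1 - 2 * k) * F * Tv * U ^+ k) *+ 'C(N, k) = d.
  by apply: eq_bigr => k _; rewrite e2 e3.
rewrite -/a -/b -/c -/d ad bc.
have mulDD (x y z w : bop V n) :
    (x + y) * (z + w) = x * z + x * w + (y * w + y * z).
  by rewrite mulrDl !mulrDr [y * z + _]addrC.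
by rewrite mulDD !mulrBB expr2 !mulrA !addrA.
Qed.

(** By the resolvent equations X and Y are multiples of powers of the inverse
    pencils, which commute with the shift operators; the binomial sums then
    become N-th powers of the pencils and cancel all but N + 1 factors. *)
Lemma binomial_part_eq s p : F_resolvent_set T s -> F_resolvent_set T p ->
  g^-1 *: (scal s ^+ h * F_R T s * F_L T p * scal p ^+ h
             + A0_term T s p + B0_term T s p + C0_term T s p)
  = g *: (Qop T s ^+ N.+1 * Qop T p ^+ N.+1).
Proof.
move=> sT pT; rewrite binomial_tail F_R_eq // F_L_eq //.
pose E x := \sum_(0 <= k < N.+1)
  (scal x ^+ (2 * (N - k)) * shift_op T x ^+ k) *+ 'C(N, k).
have EQ x : F_resolvent_set T x -> E x * Qop T x ^+ h = Qop T x ^+ N.+1.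
  move=> xT; rewrite -binomial_pencil_Q //; congr (_ * _).
  rewrite exprDn_comm /E ?big_mkord; last first.
    by apply/commr_sym/commrX/commr_sym/scal_shift_comm.
  by apply: eq_bigr => k _; rewrite exprM.
have QU x k m : F_resolvent_set T x ->
    GRing.comm (Qop T x ^+ k) (shift_op T x ^+ m).
  by move=> xT; apply/commrX/commr_sym/commrX/shift_Q_comm.
have -> : \sum_(0 <= k < N.+1) (scal s ^+ (2 * (N - k)) * (g *: Qop T s ^+ h)
    * shift_op T s ^+ k) *+ 'C(N, k) = g *: Qop T s ^+ N.+1.
  rewrite -EQ // mulr_suml scaler_sumr; apply: eq_bigr => k _.
  rewrite mulrnAl -scalerMnr -bop_scalerAr -bop_scalerAl -!mulrA.
  by rewrite QU.
have -> : \sum_(0 <= k < N.+1) (shift_op T p ^+ k * (g *: Qop T p ^+ h)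
    * scal p ^+ (2 * (N - k))) *+ 'C(N, k) = g *: Qop T p ^+ N.+1.
  rewrite -EQ // mulr_suml scaler_sumr; apply: eq_bigr => k _.
  rewrite mulrnAl -scalerMnr -bop_scalerAr -bop_scalerAl -mulrA.
  have PQ : GRing.comm (Qop T p ^+ h) (scal p ^+ (2 * (N - k))).
    by apply/commrX/commr_sym/commrX/scal_Q_comm.
  have PU : GRing.comm (shift_op T p ^+ k) (scal p ^+ (2 * (N - k))).
    by apply/commrX/commr_sym/commrX/scal_shift_comm.
  by rewrite PQ mulrA PU.
rewrite -bop_scalerAl -bop_scalerAr !scalerA mulrA mulVf ?gamma_neq0 //.
by rewrite mul1r.
Qed.

(** Writing S_R and S_L as products with the inverse pencils, the four sums
    with the index up to h - 2 are the expansion of the inner terms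
    Qs^(h-j) S_R S_L Qp^j, the first two products are the end terms j = 0 and
    j = h, and the last product on the left fills the gap i = N. *)
Lemma resolvent_products s p :
  F_resolvent_set T s -> F_resolvent_set T p ->
  let S := scal s in let P := scal p in let Qs := Qop T s in
  let Qp := Qop T p in let FR := F_R T s in let FL := F_L T p in
  FR * S_L T p + S_R T s * FL
  + g *: (S * (\sum_(0 <= i < h.-1) Qs ^+ (h - i) * Qp ^+ (i + 2)) * P
          - S * (\sum_(0 <= i < h.-1) Qs ^+ (h - i) * Tb * Qp ^+ (i + 2))
          - (\sum_(0 <= i < h.-1) Qs ^+ (h - i) * Tb * Qp ^+ (i + 2)) * P
          + \sum_(0 <= i < h.-1) Qs ^+ (h - i) * Tb ^+ 2 * Qp ^+ (i + 2)
          + \sum_(0 <= i < h | i != N) Qs ^+ (h - i) * Qp ^+ (i + 1))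
  + g *: (Qs ^+ N.+1 * Qp ^+ N.+1)
  = g *: (\sum_(0 <= j < h.+1) Qs ^+ (h - j) * (S_R T s * S_L T p) * Qp ^+ j
          + \sum_(0 <= i < h) Qs ^+ (h - i) * Qp ^+ (i + 1)).
Proof.
move=> sT pT S P Qs Qp FR FL.
have SQ : GRing.comm S Qs := scal_Q_comm sT.
have PQ : GRing.comm P Qp := scal_Q_comm pT.
have h0 : (0 < h)%N by rewrite odd_gt0.
rewrite /FR /FL F_R_S_R F_L_S_L -bop_scalerAl -bop_scalerAr -!scalerDr.
congr (_ *: _); rewrite -/Qs -/Qp.
have -> : \sum_(0 <= i < h) Qs ^+ (h - i) * Qp ^+ (i + 1)
    = \sum_(0 <= i < h | i != N) Qs ^+ (h - i) * Qp ^+ (i + 1)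
      + Qs ^+ N.+1 * Qp ^+ N.+1.
  rewrite [LHS](bigD1_seq N) ?iota_uniq //=; last first.
    by rewrite mem_index_iota /= {2}half_eq ltnS mul2n -addnn leq_addr.
  rewrite addrC addn1; congr (_ + _ ^+ _ * _).
  by rewrite {1}half_eq mul2n -addnn -addnS addKn.
have mid : S * (\sum_(0 <= i < h.-1) Qs ^+ (h - i) * Qp ^+ (i + 2)) * P
    - S * (\sum_(0 <= i < h.-1) Qs ^+ (h - i) * Tb * Qp ^+ (i + 2))
    - (\sum_(0 <= i < h.-1) Qs ^+ (h - i) * Tb * Qp ^+ (i + 2)) * P
    + \sum_(0 <= i < h.-1) Qs ^+ (h - i) * Tb ^+ 2 * Qp ^+ (i + 2)
    = \sum_(1 <= j < h) Qs ^+ (h - j) * (S_R T s * S_L T p) * Qp ^+ j.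
  rewrite [RHS]big_add1 /S_R /S_L -/S -/P -/Qs -/Qp.
  move: S P Qs Qp Tb SQ PQ => {}S {}P {}Qs {}Qp D SQ PQ.
  rewrite !mulr_sumr !mulr_suml -!sumrB -big_split /=.
  apply: eq_big_nat => i /andP[_ ih].
  have -> : Qs ^+ (h - i.+1) * (Qs * (S - D) * ((P - D) * Qp)) * Qp ^+ i.+1
      = Qs ^+ (h - i) * ((S - D) * (P - D)) * Qp ^+ (i + 2).
    rewrite addn2 [Qp ^+ i.+2]exprS -[(h - i)%N]subnSK ?exprSr ?mulrA //.
    exact: leq_trans ih (leq_pred _).
  rewrite mulrBB -expr2 !(mulrDr, mulrBr, mulrDl, mulrBl).
  rewrite -!(mulrA _ _ P) -(commrX _ PQ) !mulrA !(commrX _ SQ).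
  by rewrite !(mulrN, mulNr) !mulrA.
rewrite mid !addrA; congr (_ + _ + _).
rewrite [RHS]big_ltn // [X in _ = _ + X]big_nat_recr //.
rewrite subn0 subnn !expr0 mulr1 mul1r.
move: (S_R T s) (S_L T p) => x y.
by rewrite -!addrA !mulrA; congr (_ + _); rewrite addrC.
Qed.

End FResolventTerms.

Theorem theorem5p4 (R : realType) (V : completeNormedModType R) (n : nat)
    (n_gt3 : (3 < n)%N) (n_odd : odd n) (h_odd : odd (n.-1)./2)
    (T : bc01 V n) (p s : 'rV[R]_n.+1)
    (p_res : F_resolvent_set T p) (s_res : F_resolvent_set T s)
    (s_notin_p : ~ sphere p (paravector s)) :
  let h := (n.-1)./2 in
  let g := gamma R n in
  let S : bop V n := clop (paravector s) in
  let Sbar : bop V n := clop (paravector_conj s) in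
  let P : bop V n := clop (paravector p) in
  let Tbar := conj_op T in
  let Qs := Qop T s in
  let Qp := Qop T p in
  let FR := F_R T s in
  let FL := F_L T p in
  FR * S_L T p + S_R T s * FL
  + g *: (S * (\sum_(0 <= i < h.-1) Qs ^+ (h - i) * Qp ^+ (i + 2)) * P
          - S * (\sum_(0 <= i < h.-1) Qs ^+ (h - i) * Tbar * Qp ^+ (i + 2))
          - (\sum_(0 <= i < h.-1) Qs ^+ (h - i) * Tbar * Qp ^+ (i + 2)) * P
          + \sum_(0 <= i < h.-1) Qs ^+ (h - i) * Tbar ^+ 2 * Qp ^+ (i + 2)
          + \sum_(0 <= i < h | i != (h.-1)./2) Qs ^+ (h - i) * Qp ^+ (i + 1))
  + g^-1 *: (S ^+ h * FR * FL * P ^+ h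
             + A0_term T s p + B0_term T s p + C0_term T s p)
  = ((FR - FL) * P - Sbar * (FR - FL)) *
    clop (inverse (paravector p ^+ 2 - (2 * re_part s) *: paravector p
                   + creal n (enorm s ^+ 2))).
Proof.
move=> h g S Sbar P Tbar Qs Qp FR FL.
have [c_ci _] := inverseP (sphere_denominator_invertible
  (ltn_trans (isT : (0 < 3)%N) n_gt3) s_notin_p).
rewrite binomial_part_eq // resolvent_products // -/h -/S -/P -/Qs -/Qp.
have telescope := @sylvester_telescope _ S P (paravector_op T) Tbar Qs Qp h
  (scal_Q_comm s_res) (scal_Q_comm p_res) (S_R_eq s_res) (S_L_eq p_res).
set X := g *: _.
have XPS : X * P - S * X = FR - FL.
  rewrite /X -bop_scalerAl -bop_scalerAr -scalerBr telescope scalerBr.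
  by rewrite /FR /FL F_R_S_R // F_L_S_L.
by rewrite -XPS -mulr_sphere_denominator -mulrA -clopM c_ci clop1 mulr1.
Qed.
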